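(* Given a state space embedding $X$ with $N$ points of a univariate time series, the 0-persistence algorithm (described in the context), which estimates the 0-persistence exponent of the time series, takes $O(N^2\log N)$ time in the worst case (for large $\delta$, when each point has $N-1$ neighbors).
   Context: The 0-persistence algorithm has inputs: a finite set $X=\{\mathbf{x}_1,\dots,\mathbf{x}_N\}\subset\mathbb{R}^d$ (the embedding of a single time series), a radius $\delta>0$, a list of filtration radii $0=\epsilon_1<\dots<\epsilon_r<\dots<\epsilon_R$, and fitting bounds $\epsilon_{\text{initial}},\epsilon_{\text{final}}$. It proceeds as follows. For each $\mathbf{x}_i\in X$: (1) find the neighborhood $\bar N_\delta(\mathbf{x}_i)=\{\mathbf{x}_j\in X:\|\mathbf{x}_i-\mathbf{x}_j\|<\delta\}$ (including $\mathbf{x}_i$); (2) compute the 0-dimensional persistence barcode of the Vietoris-Rips filtration of $\bar N_\delta(\mathbf{x}_i)$; (3) for each $\epsilon_r$ in the list, let $\beta_0^{\epsilon_r}(\bar N_\delta(\mathbf{x}_i))$ be the number of barcode intervals $[b,d)$ with $b\le\epsilon_r<d$, and store $\Delta\beta(r,i)=\beta_0^{\epsilon_r}(\bar N_\delta(\mathbf{x}_i))/\beta_0^{\epsilon_1}(\bar N_\delta(\mathbf{x}_i))$. Finally, fit a linear regression to $-\ln\left(\frac1N\sum_{i=1}^N\Delta\beta(r,i)\right)$ against $\epsilon_r$ on $[\epsilon_{\text{initial}},\epsilon_{\text{final}}]$ and return its slope $\beta_{\mathrm{exp}}$. Here the Vietoris-Rips complex at radius $\epsilon$ of a point cloud is the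 set of its subsets with all pairwise distances at most $2\epsilon$. In the complexity count, computing the 0-dimensional persistent homology of a set of at most $N$ points is counted as $O(N\log N)$ computations (a cost the paper takes from the literature). *)

(* Defs.v *)
From HB Require Import structures.
From mathcomp Require Import all_boot all_order all_algebra.
From mathcomp Require Import all_classical all_reals all_analysis.

Set Implicit Arguments.
Unset Strict Implicit.
Unset Printing Implicit Defensive.

Import Order.TTheory GRing.Theory Num.Theory.
Import numFieldNormedType.Exports.

Local Open Scope ring_scope.

(* A result together with the number of elementary operations spent on it.
   [step] charges one operation: an arithmetic operation, a square root, a
   logarithm or a comparison of reals, or one list-construction or loop step. *)
Definition timed (A : Type) : Type := (A * nat)%type.

Definition value (A : Type) (c : timed A) : A := c.1.
Definition time (A : Type) (c : timed A) : nat := c.2.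

Definition ret (A : Type) (a : A) : timed A := (a, 0%N).
Definition step (A : Type) (a : A) : timed A := (a, 1%N).
Definition bind (A B : Type) (c : timed A) (f : A -> timed B) : timed B :=
  (value (f (value c)), (time c + time (f (value c)))%N).

Notation "'let!' x ':=' c 'in' k" := (bind c (fun x => k))
  (at level 200, x name, c at level 200, k at level 200, right associativity).

Fixpoint mapT (A B : Type) (f : A -> timed B) (s : seq A) : timed (seq B) :=
  if s is a :: s' then
    let! b := f a in let! bs := mapT f s' in step (b :: bs)
  else ret [::].

Fixpoint map2T (A B C : Type) (f : A -> B -> timed C) (s : seq A) (t : seq B)
    : timed (seq C) :=
  match s, t with
  | a :: s', b :: t' =>
      let! c := f a b in let! cs := map2T f s' t' in step (c :: cs)
  | _, _ => ret [::]
  end.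

Fixpoint filterT (A : Type) (p : A -> timed bool) (s : seq A) : timed (seq A) :=
  if s is a :: s' then
    let! b := p a in let! s'' := filterT p s' in
    step (if b then a :: s'' else s'')
  else ret [::].

Fixpoint foldT (A B : Type) (f : B -> A -> timed B) (z : B) (s : seq A)
    : timed B :=
  if s is a :: s' then
    let! z1 := f z a in let! z2 := step z1 in foldT f z2 s'
  else ret z.

(* The worst-case cost, over the inputs [i] of size [n] (those with [D n i]),
   is O(g n). *)
Definition worst_case_bigO (R : realType) (I : Type) (D : nat -> I -> Prop)
    (cost : I -> nat) (g : nat -> R) : Prop :=
  exists C : R, \forall n \near \oo%classic,
    forall i : I, D n i -> (cost i)%:R <= C * g n.

Section Homology.
Variables (F : fieldType) (n : nat).

Definition complex := {set {set 'I_n}}.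

(* Each simplex is oriented by the order of its vertices; chains are spanned
   by all subsets, those of a given complex are cut out by [chain_in]. *)
Definition chain := {ffun {set 'I_n} -> F^o}.

Definition chain_in (K : complex) (p : nat) (c : chain) : Prop :=
  forall s, c s != 0 -> s \in K /\ #|s| = p.+1.

(* The coefficient of a simplex [t] in the boundary of [c] collects the
   simplices [v |: t]; deleting [v] has sign (-1)^(position of v in v |: t).
   The empty simplex is excluded: homology is not reduced. *)
Definition boundary (c : chain) : chain :=
  [ffun t : {set 'I_n} => if t == finset.set0 then 0 else
    \sum_(v | v \notin t) (-1) ^+ #|[set w in t | (w < v)%N]| * c (v |: t)].

Definition is_cycle (K : complex) (p : nat) (z : chain) : Prop :=
  chain_in K p z /\ boundary z = 0.

Definition is_boundary (K : complex) (p : nat) (z : chain) : Prop :=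
  exists2 c, chain_in K p.+1 c & boundary c = z.

End Homology.

Section Barcode.
Variables (R : realType) (F : fieldType) (n : nat).

(* The half-open interval [b, d); d may be +oo. *)
Definition interv : Type := (R * \bar R)%type.

Definition alive (I : interv) (t : R) : bool := (I.1 <= t) && (t%:E < I.2)%E.

(* [B] is a barcode of the p-th persistent homology of the filtration [K]: the
   persistence module t |-> H_p(K t; F) is isomorphic to the direct sum of the
   interval modules of the members of [B] (a multiset, as a sequence). The
   isomorphism at [t] is given as a linear map [phi t] on cycles which vanishes
   exactly on boundaries, with image the coordinate space of the intervals
   alive at [t]; the last clause is compatibility with the structure maps. *)
Definition is_barcode (K : R -> complex n) (p : nat) (B : seq interv) : Prop :=
  (forall I, I \in B -> (I.1%:E < I.2)%E) /\
  exists phi : R -> {linear chain F n -> 'rV[F]_(size B)},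
  [/\ forall t z, is_cycle (K t) p z ->
        (phi t z = 0 <-> is_boundary (K t) p z),
      forall t (v : 'rV[F]_(size B)),
        (exists2 z, is_cycle (K t) p z & phi t z = v) <->
        (forall k, ~~ alive (tnth (in_tuple B) k) t -> v 0 k = 0)
    & forall s t z, s <= t -> is_cycle (K s) p z ->
        forall k, phi t z 0 k =
          if alive (tnth (in_tuple B) k) t then phi s z 0 k else 0].

End Barcode.

Section PointClouds.
Variables (R : realType) (d : nat).

(* The Euclidean distance; the library's norm on row vectors is the max norm. *)
Definition eucl_dist (x y : 'rV[R]_d) : R :=
  Num.sqrt (\sum_(i < d) (x 0 i - y 0 i) ^+ 2).

(* The Vietoris-Rips complex of [S] at radius [e]; empty when e < 0, because
   i = j is among the pairs tested. *)
Definition VR (S : seq 'rV[R]_d) (e : R) : complex (size S) :=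
  [set s : {set 'I_(size S)} | (s != finset.set0) &&
     [forall i in s, forall j in s, eucl_dist S`_i S`_j <= 2 * e]].

End PointClouds.

Record zp_input (R : realType) (d : nat) := ZPInput {
  points : seq 'rV[R]_d;
  delta : R;
  radii : seq R;
  eps_initial : R;
  eps_final : R
}.

Definition with_delta (R : realType) (d : nat) (I : zp_input R d) (dlt : R) :=
  ZPInput (points I) dlt (radii I) (eps_initial I) (eps_final I).

Definition zp_valid (R : realType) (d m : nat) (I : zp_input R d) : Prop :=
  [/\ uniq (points I), 0 < delta I,
      size (radii I) = m, ohead (radii I) = Some 0
    & sorted <%R (radii I)].

Section Algorithm.
Variables (R : realType) (d : nat).
Variable PH0 : seq 'rV[R]_d -> timed (seq (interv R)).

Definition eucl_distT (x y : 'rV[R]_d) : timed R :=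
  let! s := foldT (fun acc i =>
      let! u := step (x 0 i - y 0 i) in
      let! v := step (u * u) in
      step (acc + v)) 0 (enum 'I_d) in
  step (Num.sqrt s).

Definition neighborhoodT (X : seq 'rV[R]_d) (dlt : R) (x : 'rV[R]_d)
    : timed (seq 'rV[R]_d) :=
  filterT (fun y => let! r := eucl_distT x y in step (r < dlt)) X.

(* The number of intervals [b, d) with b <= e < d. *)
Definition bettiT (B : seq (interv R)) (e : R) : timed nat :=
  foldT (fun k J =>
      let! born := step (J.1 <= e) in
      let! not_dead := step (e%:E < J.2)%E in
      step (if born && not_dead then k.+1 else k)) 0%N B.

(* The list over r of the ratios beta_0^(eps_r) / beta_0^(eps_1) at [x]. *)
Definition delta_betaT (X : seq 'rV[R]_d) (dlt : R) (eps : seq R)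
    (x : 'rV[R]_d) : timed (seq R) :=
  let! S := neighborhoodT X dlt x in
  let! B := PH0 S in
  let! bs := mapT (bettiT B) eps in
  mapT (fun b => step (b%:R / (head 0%N bs)%:R)) bs.

(* The list over r of - ln (1/N * sum_i Delta beta (r, i)). *)
Definition neg_log_meanT (rows : seq (seq R)) (eps : seq R) : timed (seq R) :=
  let! N := foldT (fun k _ => step k.+1) 0%N rows in
  let! zeros := mapT (fun _ => step 0) eps in
  let! sums := foldT (fun acc row => map2T (fun a b => step (a + b)) acc row)
                     zeros rows in
  mapT (fun s => let! a := step (s / N%:R) in
                 let! l := step (ln a) in
                 step (- l)) sums.

Definition sumT (A : Type) (f : A -> timed R) (s : seq A) : timed R :=
  foldT (fun acc a => let! v := f a in step (acc + v)) 0 s.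

(* Least-squares slope of the data points (x, y). *)
Definition slopeT (data : seq (R * R)) : timed R :=
  let! k := sumT (fun _ => step 1) data in
  let! sx := sumT (fun q => step q.1) data in
  let! sy := sumT (fun q => step q.2) data in
  let! sxx := sumT (fun q => step (q.1 * q.1)) data in
  let! sxy := sumT (fun q => step (q.1 * q.2)) data in
  let! a := step (k * sxy) in
  let! b := step (sx * sy) in
  let! num := step (a - b) in
  let! a' := step (k * sxx) in
  let! b' := step (sx * sx) in
  let! den := step (a' - b') in
  step (num / den).

(* Returns beta_exp. *)
Definition zero_persistence (I : zp_input R d) : timed R :=
  let! rows := mapT (delta_betaT (points I) (delta I) (radii I)) (points I) in
  let! ys := neg_log_meanT rows (radii I) in
  let! data := map2T (fun e y => step (e, y)) (radii I) ys in
  let! sel := filterT (fun q =>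
      let! lo := step (eps_initial I <= q.1) in
      let! hi := step (q.1 <= eps_final I) in
      step (lo && hi)) data in
  slopeT sel.

End Algorithm.

(* Main.v *)
Require Import Defs.
From HB Require Import structures.
From mathcomp Require Import all_boot all_order all_algebra.
From mathcomp Require Import all_classical all_reals all_analysis.
From mathcomp Require Import zify ring lra.
Import Order.TTheory GRing.Theory Num.Theory.
Import numFieldNormedType.Exports.
Local Open Scope ring_scope.

(** The cost of the loop over the points splits into a part that depends on the
neighborhood of the current point and a part that depends on list sizes only.

The one quantity in the neighborhood part that the cost hypothesis on [PH0]
does not control is the number of bars: counting the bars alive at each radius
takes time proportional to it.  Here the specification of [PH0] enters: the
0-dimensional barcode of a Vietoris-Rips filtration of [n] distinct points has
exactly [n] bars ([size_VR_barcode]).  Indeed all vertices are present at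
radius 0 and nothing is present before, so every bar is born at 0; since
distinct points are at positive distance there are no edges at radius 0, so the
0-cycles at radius 0, which form a space of dimension [n], map isomorphically
onto the coordinate space of the bars.

Consequently one point costs O(N) for the distances, O(N log N) for the
persistent homology and O(N) for the Betti numbers, the dimension and the number
of radii being constants; [N] points cost O(N^2 log N), which absorbs the O(N)
cost of the averaging and of the regression ([time_zero_persistence_le]).

For the worst case, the regression part does not depend on delta, because the
filter on the data points looks at the radii only ([time_zero_persistence]).
A delta above all pairwise distances makes every neighborhood equal to the whole
cloud; any other delta gives subsequences of it, which have fewer bars and,
when the time of [PH0] is monotone, a cheaper persistence computation
([time_zero_persistence_mono]). *)

(** * The 0-dimensional barcode of a point cloud *)

Section VertexChains.
Variables (F : fieldType) (n : nat).
Implicit Types (K : complex n) (c : chain F n) (v : 'rV[F]_n).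

Definition vertex (i : 'I_n) : chain F n :=
  [ffun s : {set 'I_n} => (s == [set i]%SET)%:R].

Definition vertex_chain v : chain F n := \sum_i v 0 i *: vertex i.

Lemma vertex_chainE v (s : {set 'I_n}) :
  vertex_chain v s = \sum_i v 0 i * (s == [set i]%SET)%:R.
Proof. by rewrite /vertex_chain sum_ffunE; apply: eq_bigr => i _; rewrite !ffunE. Qed.

Lemma vertex_chain_set1 v i : vertex_chain v [set i]%SET = v 0 i.
Proof.
rewrite vertex_chainE (bigD1 i) //= eqxx mulr1 big1 ?addr0 // => j ji.
by rewrite (inj_eq (@set1_inj _)) eq_sym (negbTE ji) mulr0.
Qed.

Lemma chain0E K c : chain_in K 0 c ->
  c = vertex_chain (\row_i c [set i]%SET).
Proof.
move=> Kc; apply/ffunP => s; have [/eqP/cards1P[i ->]|s1] := eqVneq #|s| 1%N.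
  by rewrite vertex_chain_set1 mxE.
rewrite vertex_chainE big1 => [|i _].
  by apply/eqP; apply: contraNT s1 => /Kc[_ ->].
case: eqVneq => [si|_]; last by rewrite mulr0.
by rewrite si cards1 in s1.
Qed.

(** The boundary at a nonempty simplex collects coefficients of simplices with at
least two vertices, and the homology is not reduced, so that the empty simplex
has coefficient 0: every 0-chain is a cycle. *)
Lemma chain_in0_cycle K c : chain_in K 0 c -> is_cycle K 0 c.
Proof.
move=> Kc; split=> //; apply/ffunP => t; rewrite !ffunE; case: eqVneq => // t0.
rewrite big1 // => v vt; apply/eqP; rewrite mulf_eq0; apply/orP; right.
apply: contra_neqT t0 => /Kc[_]; rewrite cardsU1 vt => /eqP.
by rewrite eqSS cards_eq0 => /eqP.
Qed.

Lemma vertex_chain_in K v : (forall i, [set i]%SET \in K) ->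
  chain_in K 0 (vertex_chain v).
Proof.
move=> K1 s; rewrite vertex_chainE => s0.
have /existsP[i /eqP->] : [exists i, s == [set i]%SET].
  apply: contraNT s0 => /existsPn ns; rewrite big1 // => i _.
  by rewrite (negbTE (ns i)) mulr0.
by split; [exact: K1 | exact: cards1].
Qed.

Lemma boundary0 : boundary (0 : chain F n) = 0.
Proof.
apply/ffunP => t; rewrite !ffunE; case: eqP => // _.
by rewrite big1 // => v _; rewrite ffunE mulr0.
Qed.

End VertexChains.

(** The isomorphism with the interval modules, taken at parameter 0, is a linear
bijection from the 0-chains on [n] vertices onto the coordinate space of the
bars alive at 0, and all bars are alive at 0. *)
Lemma size_barcode0 (R : realType) (F : fieldType) (n : nat)
    (K : R -> complex n) (B : seq (interv R)) :
  (forall t, t < 0 -> K t = finset.set0) ->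
  (forall t i, 0 <= t -> [set i]%SET \in K t) ->
  (forall s, s \in K 0 -> (#|s| <= 1)%N) ->
  is_barcode F K 0 B -> size B = n.
Proof.
move=> Kneg Kvert K0 [Bne [phi [phi_ker phi_im phi_map]]].
(* The class that is the unit vector of the bar [k] at its birth lives on
   vertices, so it exists already at parameter 0, and so does the bar. *)
have aliveT k : alive (tnth (in_tuple B) k) 0.
  set I := tnth _ k; have IB : (I.1%:E < I.2)%E.
    by apply: Bne; rewrite /I mem_tnth.
  have aI : alive I I.1 by rewrite /alive lexx IB.
  have [z [zc zb] zk] : exists2 z, is_cycle (K I.1) 0 z & phi I.1 z = delta_mx 0 k.
    apply/phi_im => j; apply: contraNeq; rewrite mxE eqxx /=.
    by have [->|_] := eqVneq j k; rewrite ?aI /= ?eqxx.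
  have z1 : phi I.1 z 0 k = 1 by rewrite zk mxE !eqxx.
  have [I0|I0] := ltP I.1 0.
    have z0 : z = 0.
      apply/ffunP => s; rewrite ffunE; apply/eqP; apply: contraT => /zc[].
      by rewrite Kneg // finset.in_set0.
    by move/eqP: z1; rewrite z0 raddf0 mxE eq_sym oner_eq0.
  have zc0 : is_cycle (K 0) 0 z.
    rewrite (chain0E _ _ _ _ zc).
    by apply/chain_in0_cycle/vertex_chain_in => i; apply: Kvert.
  apply: contraT => na; move: (phi_map _ _ _ I0 zc0 k).
  rewrite -/I aI z1 => /esym/eqP; rewrite (_ : phi 0 z 0 k = 0) ?(eq_sym 0) ?oner_eq0 //.
  by apply: (proj1 (phi_im 0 (phi 0 z))) => //; exists z.
(* The matrix of the isomorphism at 0 in the basis of the vertices. *)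
pose M : 'M[F]_(n, size B) := \matrix_i phi 0 (vertex F n i).
have phiE v : phi 0 (vertex_chain F n v) = v *m M.
  rewrite mulmx_sum_row linear_sum; apply: eq_bigr => i _.
  by rewrite linearZ rowK.
(* There are no edges at 0, hence no nonzero boundaries. *)
have free : row_free M.
  apply: inj_row_free => v; rewrite -phiE => v0.
  have vc : is_cycle (K 0) 0 (vertex_chain F n v).
    by apply/chain_in0_cycle/vertex_chain_in => i; apply: Kvert.
  have [c cc cv] := proj1 (phi_ker _ _ vc) v0.
  have c0 : c = 0.
    apply/ffunP => s; rewrite ffunE; apply/eqP; apply: contraT => /cc[/K0].
    by move=> s1 s2; rewrite s2 in s1.
  by apply/rowP => i; rewrite -vertex_chain_set1 -cv c0 boundary0 ffunE mxE.
have full : row_full M.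
  rewrite -sub1mx; apply/row_subP => i.
  have [|z [zc _] <-] := proj2 (phi_im 0 (row i 1%:M)).
    by move=> k; rewrite aliveT.
  by rewrite (chain0E _ _ _ _ zc) phiE submxMl.
by rewrite -(eqP free) (eqP full).
Qed.

Section Distance.
Variables (R : realType) (d : nat).
Implicit Types (x y : 'rV[R]_d) (S : seq 'rV[R]_d).

Lemma eucl_dist_ge0 x y : 0 <= eucl_dist x y.
Proof. exact: sqrtr_ge0. Qed.

Lemma eucl_distxx x : eucl_dist x x = 0.
Proof. by rewrite /eucl_dist big1 ?sqrtr0 // => i _; rewrite subrr expr0n. Qed.

Lemma eucl_dist_le0 x y : eucl_dist x y <= 0 -> x = y.
Proof.
rewrite /eucl_dist => xy; have {xy} : Num.sqrt (\sum_(i < d) (x 0 i - y 0 i) ^+ 2) == 0.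
  by rewrite eq_le xy sqrtr_ge0.
rewrite sqrtr_eq0 => s0; have sq i : true -> 0 <= (x 0 i - y 0 i) ^+ 2 by rewrite sqr_ge0.
have /eqP : \sum_(i < d) (x 0 i - y 0 i) ^+ 2 = 0.
  by apply/eqP; rewrite eq_le s0 sumr_ge0.
rewrite psumr_eq0 // => /allP xy; apply/rowP => i; apply/eqP.
by rewrite -subr_eq0 -sqrf_eq0; exact: (xy i (mem_index_enum i)).
Qed.

Lemma size_VR_barcode (F : fieldType) S B :
  uniq S -> is_barcode F (VR S) 0 B -> size B = size S.
Proof.
move=> uS; apply: size_barcode0 => [t t0|t i t0|s].
- apply/setP => s; rewrite !inE; apply/negbTE/negP => /andP[/set0Pn[i si]].
  move=> /forall_inP/(_ _ si)/forall_inP/(_ _ si).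
  by rewrite eucl_distxx; lra.
- rewrite inE; apply/andP; split; first by apply/set0Pn; exists i; rewrite inE.
  apply/forall_inP => j /set1P->; apply/forall_inP => k /set1P->.
  by rewrite eucl_distxx; lra.
rewrite inE => /andP[_ /forall_inP sP]; apply/card_le1_eqP => i j si sj.
have := forall_inP (sP _ si) _ sj; rewrite mulr0 => /eucl_dist_le0/eqP.
by rewrite nth_uniq // => /eqP ij; apply: val_inj.
Qed.

End Distance.

(** * Cost of the list combinators *)

Lemma time_bind (A B : Type) (c : timed A) (f : A -> timed B) :
  time (bind c f) = (time c + time (f (value c)))%N.
Proof. by []. Qed.

Lemma value_bind (A B : Type) (c : timed A) (f : A -> timed B) :
  value (bind c f) = value (f (value c)).
Proof. by []. Qed.

Lemma value_mapT (A B : Type) (f : A -> timed B) (s : seq A) :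
  value (mapT f s) = [seq value (f a) | a <- s].
Proof. by elim: s => //= a s IH; rewrite IH. Qed.

Lemma size_mapT (A B : Type) (f : A -> timed B) (s : seq A) :
  size (value (mapT f s)) = size s.
Proof. by rewrite value_mapT size_map. Qed.

Lemma time_mapT (A B : Type) (f : A -> timed B) (s : seq A) :
  time (mapT f s) = (\sum_(a <- s) (time (f a)).+1)%N.
Proof.
elim: s => [|a s IH] /=; first by rewrite big_nil.
by rewrite IH big_cons /=; lia.
Qed.

Lemma time_mapT_const (A B : Type) (f : A -> timed B) (s : seq A) k :
  (forall a, time (f a) = k) -> time (mapT f s) = (size s * k.+1)%N.
Proof.
move=> fk; rewrite time_mapT; under eq_bigr do rewrite fk.
by rewrite big_const_seq count_predT iter_addn_0 mulnC.
Qed.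

Lemma value_map2T (A B C : Type) (f : A -> B -> timed C) (s : seq A) (t : seq B) :
  value (map2T f s t) = [seq value (f q.1 q.2) | q <- zip s t].
Proof. by elim: s t => [|a s IH] [|b t] //=; rewrite IH. Qed.

Lemma time_map2T_const (A B C : Type) (f : A -> B -> timed C) s t k :
  (forall a b, time (f a b) = k) -> size s = size t ->
  time (map2T f s t) = (size s * k.+1)%N.
Proof.
move=> fk; elim: s t => [|a s IH] [|b t] //= [] /IH {}IH.
by rewrite IH fk /=; lia.
Qed.

Lemma value_filterT (A : Type) (p : A -> timed bool) (s : seq A) :
  value (Defs.filterT p s) = [seq a <- s | value (p a)].
Proof. by elim: s => //= a s IH; rewrite IH. Qed.

Lemma time_filterT_const (A : Type) (p : A -> timed bool) (s : seq A) k :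
  (forall a, time (p a) = k) -> time (Defs.filterT p s) = (size s * k.+1)%N.
Proof. by move=> pk; elim: s => //= a s IH; rewrite IH pk /=; lia. Qed.

(** The cost of a fold whose step has a constant cost only along an invariant of
the accumulator, as happens when rows of a fixed length are added up. *)
Lemma foldT_inv (A B : Type) (f : B -> A -> timed B) (P : B -> Prop)
    (Q : A -> bool) k z s :
  (forall b a, P b -> Q a -> time (f b a) = k /\ P (value (f b a))) ->
  P z -> all Q s ->
  time (foldT f z s) = (size s * k.+1)%N /\ P (value (foldT f z s)).
Proof.
move=> fP; elim: s z => [|a s IH] z //= Pz /andP[Qa Qs].
have [tk Pf] := fP z a Pz Qa.
by have [-> ?] := IH _ Pf Qs; rewrite tk; split=> //=; lia.
Qed.

Lemma time_foldT_const (A B : Type) (f : B -> A -> timed B) z s k :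
  (forall b a, time (f b a) = k) -> time (foldT f z s) = (size s * k.+1)%N.
Proof.
by move=> fk; apply: (proj1 (foldT_inv _ _ f xpredT xpredT k z s _ _ _)) => //;
  rewrite all_predT.
Qed.

(** * Exact cost of the stages of the algorithm *)

Section Costs.
Variables (R : realType) (d : nat).
Implicit Types (x y : 'rV[R]_d) (X : seq 'rV[R]_d).

Lemma value_foldT (A B : Type) (f : B -> A -> timed B) z s :
  value (foldT f z s) = foldl (fun b a => value (f b a)) z s.
Proof. by elim: s z => //= a s IH z; rewrite IH. Qed.

Lemma value_eucl_distT x y : value (eucl_distT x y) = eucl_dist x y.
Proof.
rewrite /eucl_distT value_bind value_foldT /=; congr Num.sqrt.
have foldl_add (s : seq 'I_d) z :
    foldl (fun b a => b + (x 0 a - y 0 a) * (x 0 a - y 0 a)) z s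
    = z + \sum_(a <- s) (x 0 a - y 0 a) ^+ 2.
  elim: s z => [|a s IH] z /=; first by rewrite big_nil addr0.
  by rewrite IH big_cons addrA.
by rewrite foldl_add add0r big_enum.
Qed.

Lemma value_neighborhoodT X dlt x :
  value (neighborhoodT X dlt x) = [seq y <- X | eucl_dist x y < dlt].
Proof.
rewrite /neighborhoodT value_filterT; apply: eq_filter => y.
by rewrite value_bind value_eucl_distT.
Qed.

Lemma time_eucl_distT x y : time (eucl_distT x y) = (d * 4).+1.
Proof.
rewrite /eucl_distT time_bind (time_foldT_const _ _ _ _ _ 3) //.
by rewrite size_enum_ord addn1.
Qed.

Lemma time_neighborhoodT X dlt x :
  time (neighborhoodT X dlt x) = (size X * (d * 4 + 3))%N.
Proof.
rewrite /neighborhoodT (time_filterT_const _ _ _ (d * 4).+2) ?addn3 // => y.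
by rewrite time_bind time_eucl_distT addn1.
Qed.

Lemma time_bettiT (B : seq (interv R)) e : time (bettiT B e) = (size B * 4)%N.
Proof. by rewrite /bettiT (time_foldT_const _ _ _ _ _ 3). Qed.

Lemma time_delta_betaT PH0 X dlt eps x :
  time (delta_betaT PH0 X dlt eps x) =
  (size X * (d * 4 + 3) + time (PH0 (value (neighborhoodT X dlt x)))
   + size eps * (size (value (PH0 (value (neighborhoodT X dlt x)))) * 4 + 3))%N.
Proof.
rewrite /delta_betaT !time_bind time_neighborhoodT.
rewrite (time_mapT_const _ _ _ _ _ (fun e => time_bettiT _ e)).
rewrite (time_mapT_const _ _ _ _ 1) // value_mapT size_map; lia.
Qed.

Lemma size_delta_betaT PH0 X dlt eps x :
  size (value (delta_betaT PH0 X dlt eps x)) = size eps.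
Proof. by rewrite /delta_betaT !value_bind !value_mapT !size_map. Qed.

Lemma neg_log_meanT_cost (rows : seq (seq R)) (eps : seq R) :
  all (fun r => size r == size eps) rows ->
  time (neg_log_meanT rows eps) =
    (size rows * (size eps * 2 + 3) + size eps * 6)%N
  /\ size (value (neg_log_meanT rows eps)) = size eps.
Proof.
move=> rowsP; rewrite /neg_log_meanT !time_bind !value_bind.
rewrite (time_foldT_const _ _ _ _ _ 1) // (time_mapT_const _ _ _ _ 1) //.
have z0 : size (value (mapT (fun=> step 0) eps) : seq R) = size eps.
  by rewrite value_mapT size_map.
have [|-> sz] := foldT_inv _ _
  (fun acc row => map2T (fun a b : R => step (a + b)) acc row)
  (fun acc => size acc = size eps) (fun r => size r == size eps)
  (size eps * 2)%N _ _ _ z0 rowsP.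
  move=> acc row sa /eqP sr; rewrite (time_map2T_const _ _ _ _ _ _ 1) ?sa //.
  by split=> //; rewrite value_map2T [size _]size_map size_zip sa sr minnn.
split; last by rewrite -[RHS]sz; exact: size_mapT.
set t := time _; have -> : t = (size eps * 4)%N.
  by rewrite -sz; exact: time_mapT_const.
by lia.
Qed.

Lemma time_sumT (A : Type) (f : A -> timed R) s :
  (forall a, time (f a) = 1%N) -> time (sumT f s) = (size s * 3)%N.
Proof.
by move=> f1; rewrite /sumT (time_foldT_const _ _ _ _ _ 2) // => b a; rewrite time_bind f1.
Qed.

Lemma time_slopeT (data : seq (R * R)) :
  time (slopeT data) = (size data * 15 + 7)%N.
Proof. by rewrite /slopeT !time_bind !time_sumT //=; lia. Qed.

(** The averaging, the selection of the data points in the fitting window and the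
least-squares fit: it is a function of the number of points and of the radii,
so it is the same for every delta. *)
Definition regression_cost N (eps : seq R) (lo hi : R) : nat :=
  (N * (size eps * 2 + 3) + size eps * 12
   + count (fun e => (lo <= e)%R && (e <= hi)%R) eps * 15 + 7)%N.

Lemma time_zero_persistence PH0 (I : zp_input R d) :
  time (zero_persistence PH0 I) =
  (\sum_(x <- points I) (time (delta_betaT PH0 (points I) (delta I) (radii I) x)).+1
   + regression_cost (size (points I)) (radii I) (eps_initial I) (eps_final I))%N.
Proof.
rewrite /zero_persistence time_bind time_mapT /regression_cost; congr addn.
set rows := value (mapT _ _).
have sr : size rows = size (points I) by rewrite /rows value_mapT size_map.
have rowsP : all (fun r => size r == size (radii I)) rows.
  rewrite /rows value_mapT all_map; apply/allP => x _ /=.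
  by rewrite size_delta_betaT.
have [tn sn] := neg_log_meanT_cost _ _ rowsP.
rewrite time_bind tn time_bind (time_map2T_const _ _ _ _ _ _ 1) //.
rewrite time_bind (time_filterT_const _ _ _ 3) // time_slopeT value_filterT value_map2T.
move: sn; set ys := value (neg_log_meanT _ _) => sn.
rewrite size_map size_zip sn minnn sr size_filter count_map /=.
(* The selection tests the first components only, which are the radii. *)
set c := count _ _; set c' := count _ _.
have -> : c = c'.
  by rewrite /c /c' -[in RHS](unzip1_zip (eq_leq (esym sn))) count_map.
by lia.
Qed.

End Costs.

(** * Bounds for the whole algorithm *)

Section Bounds.
Variables (R : realType) (F : fieldType) (d m : nat).
Variable PH0 : seq 'rV[R]_d -> timed (seq (interv R)).
Hypothesis PH0_correct : forall S : seq 'rV[R]_d, uniq S ->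
  is_barcode F (VR S) 0 (value (PH0 S)).
Implicit Types (I : zp_input R d).

(** Correctness of [PH0] replaces the number of bars by the size of the
neighborhood. *)
Lemma time_delta_betaT_uniq X dlt eps x : uniq X ->
  let S := [seq y <- X | eucl_dist x y < dlt] in
  time (delta_betaT PH0 X dlt eps x) =
  (size X * (d * 4 + 3) + time (PH0 S) + size eps * (size S * 4 + 3))%N.
Proof.
move=> uX S; rewrite time_delta_betaT value_neighborhoodT.
by rewrite (size_VR_barcode _ _ _ _ _ _ (PH0_correct _ (filter_uniq _ uX))) ?filter_uniq.
Qed.

(** The bound keeps the cost [p] of one persistence computation apart; the
coefficient of N^2 collects everything else, the lower-order terms being
estimated by N^2. *)
Lemma time_zero_persistence_le I p :
  zp_valid m I ->
  (forall S, uniq S -> (size S <= size (points I))%N -> (time (PH0 S) <= p)%N) ->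
  (0 < size (points I))%N ->
  (time (zero_persistence PH0 I) <=
   size (points I) ^ 2 * (d * 4 + m * 36 + 14) + size (points I) * p)%N.
Proof.
case=> uX _ sm _ _; set N := size _ => le_p N0.
rewrite time_zero_persistence /regression_cost sm -/N.
have c_m := count_size (fun e => (eps_initial I <= e) && (e <= eps_final I)) (radii I).
rewrite sm in c_m.
have : (\sum_(x <- points I)
    (time (delta_betaT PH0 (points I) (delta I) (radii I) x)).+1
    <= \sum_(x <- points I) (N * (d * 4 + 3) + p + m * (N * 4 + 3)).+1)%N.
  apply: leq_sum => x _; rewrite time_delta_betaT_uniq // sm -/N ltnS.
  have sS : (size [seq y <- points I | (eucl_dist x y < delta I)%R] <= N)%N.
    by rewrite size_filter count_size.
  rewrite leq_add ?leq_add2l ?le_p ?filter_uniq //.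
  by rewrite leq_mul // leq_add2r leq_mul.
rewrite big_const_seq count_predT iter_addn_0 -/N -mulnn => sum_le.
have N1 : (N <= N * N)%N by rewrite leq_pmulr.
have mN : (m <= m * N)%N by rewrite leq_pmulr.
have mN2 : (m * N <= m * N * N)%N by rewrite leq_pmulr.
by lia.
Qed.

(** With [delta1] above the diameter every neighborhood is the whole cloud, of
which the neighborhoods for [delta2] are subsequences. *)
Lemma time_zero_persistence_mono I delta1 delta2 :
  (forall S S' : seq 'rV[R]_d, uniq S' -> subseq S S' ->
      (time (PH0 S) <= time (PH0 S'))%N) ->
  zp_valid m I ->
  {in points I &, forall x y, eucl_dist x y < delta1} ->
  (time (zero_persistence PH0 (with_delta I delta2))
    <= time (zero_persistence PH0 (with_delta I delta1)))%N.
Proof.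
move=> PH0_mono [uX _ _ _ _] delta1_big.
have E dlt : time (zero_persistence PH0 (with_delta I dlt)) =
    (\sum_(x <- points I) (time (delta_betaT PH0 (points I) dlt (radii I) x)).+1
     + regression_cost R (size (points I)) (radii I) (eps_initial I) (eps_final I))%N.
  exact: time_zero_persistence.
rewrite [leqLHS]E [leqRHS]E leq_add2r.
rewrite big_seq [in leqRHS]big_seq; apply: leq_sum => x xX.
rewrite !time_delta_betaT_uniq // ltnS.
have -> : [seq y <- points I | eucl_dist x y < delta1] = points I.
  by apply/all_filterP/allP => y yX; apply: delta1_big.
have sub := filter_subseq (fun y => eucl_dist x y < delta2) (points I).
apply: leq_add; first by rewrite leq_add2l; exact: PH0_mono.
by rewrite leq_mul2l leq_add2r leq_mul2r (size_subseq sub) !orbT.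
Qed.

End Bounds.

Lemma eucl_dist_bounded (R : realType) (d : nat) (X : seq 'rV[R]_d) :
  exists2 r, 0 < r & {in X &, forall x y, eucl_dist x y < r}.
Proof.
exists (1 + \sum_(x <- X) \sum_(y <- X) eucl_dist x y).
  by rewrite ltr_pwDl ?ltr01 // !sumr_ge0 // => *; rewrite sumr_ge0 // => *; exact: eucl_dist_ge0.
move=> x y xX yX; rewrite (big_rem x) //= (big_rem y) //=.
set a := \sum_(_ <- _) _; set b := \sum_(_ <- _) _.
have a0 : 0 <= a by rewrite sumr_ge0 // => *; exact: eucl_dist_ge0.
have b0 : 0 <= b by rewrite sumr_ge0 // => *; rewrite sumr_ge0 // => *; exact: eucl_dist_ge0.
by lra.
Qed.

Theorem mainTheorem5 (R : realType) (F : fieldType) (d m : nat)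
    (PH0 : seq 'rV[R]_d -> timed (seq (interv R)))
    (PH0_correct : forall S : seq 'rV[R]_d, uniq S ->
       is_barcode F (VR S) 0 (value (PH0 S)))
    (PH0_cost : worst_case_bigO
       (fun (n : nat) (S : seq 'rV[R]_d) => uniq S /\ (size S <= n)%N)
       (fun S => time (PH0 S))
       (fun n => n%:R * ln (n%:R : R))) :
  worst_case_bigO
    (fun (N : nat) (I : zp_input R d) => zp_valid m I /\ size (points I) = N)
    (fun I => time (zero_persistence PH0 I))
    (fun N => N%:R ^+ 2 * ln (N%:R : R))
  /\
  ((forall S S' : seq 'rV[R]_d, uniq S' -> subseq S S' ->
      (time (PH0 S) <= time (PH0 S'))%N) ->
   forall I : zp_input R d, zp_valid m I ->
   exists2 delta0 : R, 0 < delta0 &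
   forall delta1 : R, delta0 <= delta1 ->
     (forall x : 'rV[R]_d, x \in points I ->
        count (fun y => (y != x) && (eucl_dist x y < delta1)) (points I)
          = (size (points I)).-1) /\
     (forall delta2 : R, 0 < delta2 ->
        (time (zero_persistence PH0 (with_delta I delta2))
          <= time (zero_persistence PH0 (with_delta I delta1)))%N)).
Proof.
split.
  have [C0 PH0_le] := PH0_cost.
  exists ((d * 4 + m * 36 + 14)%:R + C0); near=> N => I [Iv sN].
  (* From e on, the logarithm is at least 1, so N^2 is below N^2 ln N. *)
  have eN : expR 1 <= N%:R :> R by near: N; exact: nbhs_infty_ger.
  have N0 : (0 < N)%N.
    by rewrite -(ltr0n R) (lt_le_trans _ eN) ?expR_gt0.
  have lnN : 1 <= ln N%:R :> R.
    by rewrite -{1}[1 : R]expRK ler_ln // posrE ?expR_gt0 // ltr0n.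
  have PH0N : forall S : seq 'rV[R]_d, uniq S /\ (size S <= N)%N ->
      (time (PH0 S))%:R <= C0 * (N%:R * ln N%:R).
    by near: N.
  (* A natural number p is extracted from the real bound, which is nonnegative
     since it dominates a running time. *)
  have t0 : 0 <= C0 * (N%:R * ln N%:R).
    by apply: le_trans (PH0N [::] _).
  set p := Num.trunc (C0 * (N%:R * ln N%:R)).
  have := time_zero_persistence_le _ _ _ _ _ PH0_correct I p Iv.
  rewrite sN => /(_ _ N0) le_time.
  have {}le_time : (time (zero_persistence PH0 I) <= N ^ 2 * (d * 4 + m * 36 + 14) + N * p)%N.
    by apply: le_time => S uS sS; rewrite /p truncn_ge_nat // PH0N // -sN.
  rewrite -(ler_nat R) in le_time; apply: le_trans le_time _.
  have pC : p%:R <= C0 * (N%:R * ln N%:R) by rewrite truncn_le.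
  rewrite natrD mulrDl; apply: lerD.
    rewrite mulnC natrM natrX ler_wpM2l ?ler0n //.
    by rewrite ler_peMr ?exprn_ge0 ?ler0n.
  rewrite natrM (_ : C0 * _ = N%:R * (C0 * (N%:R * ln N%:R))); last by ring.
  by rewrite ler_wpM2l.
move=> PH0_mono I Iv; have [r r0 rP] := eucl_dist_bounded R d (points I).
exists r; first exact: r0.
move=> delta1 r1; have {}rP : {in points I &, forall x y, eucl_dist x y < delta1}.
  by move=> x y xX yX; apply: lt_le_trans (rP x y xX yX) r1.
split; last first.
  move=> delta2 _.
  exact: (time_zero_persistence_mono _ F _ m _ PH0_correct _ _ _ PH0_mono Iv rP).
move=> x xX.
have [uX _ _ _ _] := Iv.
rewrite -(count_predC (pred1 x)) count_uniq_mem // xX add1n /=.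
by apply: eq_in_count => y yX /=; rewrite rP // andbT.
Unshelve. all: by end_near.
Qed.
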